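(* Let $d=2m+1$ be an odd positive integer, and let $G$ be the Lie group of matrices $M(\alpha',a,b,c)$ described in the context. Let $\Lambda=\langle g_0,g_1,\dots,g_{2d},h_1,\dots,h_{d^2}\rangle\subset G$ be any subgroup obtained by the construction described in the context. Then $\Lambda$ is a cocompact lattice in $G$, i.e. a discrete subgroup of $G$ with compact quotient.
   Context: The group $G$. Let $m\ge 0$ and $d=2m+1$. For $\alpha'\in\mathbb{R}_{>0}$, $a=(a_1,\dots,a_d)\in\mathbb{R}^d$, $b=(b_1,\dots,b_d)\in\mathbb{R}^d$ and a real $d\times d$ array $c=(c_{ij})$, let $M(\alpha',a,b,c)$ be the $(2d+1)\times(2d+1)$ real matrix in block form $\begin{pmatrix} I_d & b & c\\ 0&\alpha'&a\\ 0&0&I_d\end{pmatrix}$, where $a$ is a row, $b$ a column, and the first $d$ rows are numbered from bottom to top: $b_i$ lies in row $d+1-i$, and $c_{ij}$ is the entry in the row containing $b_i$ and the column containing $a_j$. $G$ is the Lie group of all such matrices under matrix multiplication. Let $\mathcal{Z}=\{M(1,0,0,c)\}\cong\mathbb{R}^{d^2}$. Construction of $\Lambda$. (1) Pick $N=(n_{k,j})\in SL_{2d}(\mathbb{Z})$ diagonalizable over $\mathbb{R}$ with eigenvalues $\alpha$ and $1/\alpha$, each of multiplicity $d$, where $\alpha>1$ is a real quadratic algebraic integer. (2) Pick bases $(a_i^1,\dots,a_i^{2d})$, $1\le i\le d$, of the real eigenspace of $N$ (acting on column vectors) for $\alpha$, and $(b_i^1,\dots,b_i^{2d})$, $1\le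 i\le d$, of the real eigenspace for $1/\alpha$; so $\alpha a_i^k=\sum_j n_{k,j}a_i^j$ and $\frac1\alpha b_i^k=\sum_j n_{k,j}b_i^j$. (3) Put $e_{ij}^{s,t}=b_i^sa_j^t-a_j^sb_i^t$ and $z^{s,t}=M(1,0,0,(e_{ij}^{s,t}))$ for $1\le s,t\le 2d$. Pick any cocompact lattice $D$ of $\mathcal{Z}$ containing all $z^{s,t}$, with generators $h_k=M(1,0,0,(d_{ij}^k))$, $1\le k\le d^2$. (4) Pick any integer matrix $P=(p_{k,l})$ of size $2d\times d^2$. For each $i,j$ let $(c_{ij}^1,\dots,c_{ij}^{2d})$ be the unique solution of the linear system $c_{ij}^k=\sum_{s=1}^{2d}n_{k,s}c_{ij}^s+f_{ij}^k+\sum_{l=1}^{d^2}p_{k,l}d_{ij}^l$ ($1\le k\le 2d$), where $f_{ij}^k=\sum_{s=1}^{2d}\frac{n_{k,s}(n_{k,s}-1)}{2}b_i^sa_j^s+\sum_{1\le s<t\le 2d}n_{k,s}n_{k,t}b_i^sa_j^t$ (the solution is unique since $1$ is not an eigenvalue of $N$). (5) Put $g_k=M(1,(a_i^k)_i,(b_j^k)_j,(c_{ij}^k))$ for $1\le k\le 2d$, $g_0=M(\alpha,0,0,0)$, and $\Lambda=\langle g_0,g_1,\dots,g_{2d},h_1,\dots,h_{d^2}\rangle$. *)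

(* Defs.v *)
From HB Require Import structures.
From mathcomp Require Import all_boot all_order all_algebra.
From mathcomp Require Import all_classical all_reals all_analysis.
Import Order.TTheory GRing.Theory Num.Theory.
Import numFieldNormedType.Exports.

Set Implicit Arguments.
Unset Strict Implicit.
Unset Printing Implicit Defensive.

Local Open Scope classical_set_scope.
Local Open Scope ring_scope.

Definition is_matrix_group (R : realType) (n : nat) (H : set 'M[R]_n) : Prop :=
  [/\ forall x, H x -> x \in unitmx,
      H 1%:M,
      forall x y, H x -> H y -> H (x *m y)
    & forall x, H x -> H (invmx x)].

(* <S>: the least matrix group containing S; it is only meaningful when every
   element of S is invertible. *)
Definition matrix_group_generated (R : realType) (n : nat) (S : set 'M[R]_n) :
    set 'M[R]_n :=
  smallest (@is_matrix_group R n) S.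

Section CosetSpace.
Variables (R : realType) (n : nat) (G H : set 'M[R]_n).

Definition left_coset (x : 'M[R]_n) : set 'M[R]_n := [set x *m h | h in H].

Definition same_left_coset (x y : G) : bool :=
  `[< left_coset (\val x) = left_coset (\val y) >].

Lemma same_left_coset_refl : reflexive same_left_coset.
Proof. by move=> x; apply/asboolP. Qed.

Lemma same_left_coset_sym : symmetric same_left_coset.
Proof. by move=> x y; apply/asboolP/asboolP => ->. Qed.

Lemma same_left_coset_trans : transitive same_left_coset.
Proof. by move=> y x z /asboolP xy /asboolP yz; apply/asboolP; rewrite xy. Qed.

Canonical same_left_coset_equiv :=
  EquivRel same_left_coset
    same_left_coset_refl same_left_coset_sym same_left_coset_trans.

(* G / H with the quotient topology; G carries the subspace topology inherited
   from the space of all matrices. *)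
Definition coset_space : topologicalType :=
  quotient_topology {eq_quot same_left_coset}%qT.

End CosetSpace.

Definition cocompact_lattice (R : realType) (n : nat) (G L : set 'M[R]_n) :
    Prop :=
  [/\ is_matrix_group L, L `<=` G, isolated L = L
    & compact [set: coset_space G L]].

Section Group.
Variables (R : realType) (d : nat).

(* The index reversal in the blocks b and c expresses that the first d rows are
   numbered from bottom to top. *)
Definition Mx (alpha' : R) (a b : 'rV[R]_d) (c : 'M[R]_d) :
    'M[R]_(d + (1 + d)) :=
  block_mx
    1%:M (row_mx (\col_r b 0 (rev_ord r)) (\matrix_(r, j) c (rev_ord r) j))
    0    (block_mx alpha'%:M a
                   0         1%:M).

Definition groupG : set 'M[R]_(d + (1 + d)) :=
  [set x | exists alpha' a b c, 0 < alpha' /\ x = Mx alpha' a b c].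

Definition subgroupZ : set 'M[R]_(d + (1 + d)) :=
  [set x | exists c, x = Mx 1 0 0 c].

End Group.

Definition quadratic_algebraic_integer (R : realType) (x : R) : Prop :=
  exists p : {poly int},
    [/\ p \is monic, size p = 3%N,
        irreducible_poly (map_poly (intr : int -> rat) p)
      & root (map_poly (intr : int -> R) p) x].

Section Construction.
Variables (R : realType) (d : nat).

Definition intmx_to_real (N : 'M[int]_(2 * d)) : 'M[R]_(2 * d) := map_mx intr N.

(* The rows of V form a basis of the eigenspace of N acting on column vectors;
   the library's eigenspace is that of the action on row vectors, whence the
   transposition. *)
Definition is_eigenbasis (N : 'M[int]_(2 * d)) (x : R) (V : 'M[R]_(d, 2 * d)) :
    Prop :=
  row_free V /\ (V == eigenspace (intmx_to_real N)^T x)%MS.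

(* In what follows A i k, B i k, C k i j and h k i j stand for a_i^k, b_i^k,
   c_{ij}^k and d_{ij}^k. *)
Variables A B : 'M[R]_(d, 2 * d).

Definition e_mx (s t : 'I_(2 * d)) : 'M[R]_d :=
  \matrix_(i, j) (B i s * A j t - A j s * B i t).

Definition f_mx (N : 'M[int]_(2 * d)) (k : 'I_(2 * d)) : 'M[R]_d :=
  let n := intmx_to_real N in
  \matrix_(i, j)
    (\sum_(s < 2 * d) n k s * (n k s - 1) / 2 * B i s * A j s
     + \sum_(s < 2 * d) \sum_(t < 2 * d | (s < t)%N) n k s * n k t * B i s * A j t).

Definition z_gen (s t : 'I_(2 * d)) : 'M[R]_(d + (1 + d)) :=
  Mx 1 0 0 (e_mx s t).

Definition h_gen (h : 'I_(d ^ 2) -> 'M[R]_d) (k : 'I_(d ^ 2)) :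
    'M[R]_(d + (1 + d)) :=
  Mx 1 0 0 (h k).

Definition g_gen (C : 'I_(2 * d) -> 'M[R]_d) (k : 'I_(2 * d)) :
    'M[R]_(d + (1 + d)) :=
  Mx 1 (col k A)^T (col k B)^T (C k).

Definition g0 (alpha : R) : 'M[R]_(d + (1 + d)) := Mx alpha 0 0 0.

Definition Lambda (alpha : R) (C : 'I_(2 * d) -> 'M[R]_d)
    (h : 'I_(d ^ 2) -> 'M[R]_d) : set 'M[R]_(d + (1 + d)) :=
  matrix_group_generated ([set g0 alpha] `|` range (g_gen C) `|` range (h_gen h)).

End Construction.

(* Main.v *)
Require Import Defs.
From mathcomp Require Import all_boot all_order all_algebra.
From mathcomp Require Import all_classical all_reals all_analysis.
From mathcomp Require Import ring lra.
Import Order.TTheory GRing.Theory Num.Theory.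
Import numFieldNormedType.Exports.

Set Implicit Arguments.
Unset Strict Implicit.
Unset Printing Implicit Defensive.

Local Open Scope classical_set_scope.
Local Open Scope ring_scope.

(** Let K be the set of c with M(1,0,0,c) in D, and for m in Z^{2d} let a(m),
b(m), gamma(m) be the blocks of the ordered product g_1^{m_1} ... g_{2d}^{m_{2d}}.
Modulo K one has gamma(m + m') = gamma(m) + gamma(m') + b(m) a(m'), because the
reordering error is a combination of the e^{s,t}; and gamma(mN) = gamma(m),
because the difference is additive modulo K and the choice of C makes it vanish
on the unit vectors.  As conjugation by g_0 sends (a, b, c) to
(alpha a, b / alpha, c), i.e. m to mN, the matrices
M(alpha^n, alpha^n a(m), b(m), c) with c in gamma(m) + K form a group, and it
contains Lambda.  It is discrete, since the powers of alpha, the vectors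
(a(m), b(m)) and K are.

For compactness, every coset of Lambda meets a fixed bounded set with scalar
entry in [1, alpha]: multiply by a power of g_0, then round the coordinates of
(a, b) in the basis (a^k, b^k), then round c.  The last step needs only that K
contains the e^{s,t}, as these span all d x d matrices over R. *)

(** * Sup norm of matrices and rounding to integers *)

Section MatrixNorm.
Variable R : realType.

Lemma mx_norm_ltP m n (X : 'M[R]_(m, n)) e : 0 < e ->
  reflect (forall i j, `|X i j| < e) (`|X| < e).
Proof.
move=> e0; rewrite [`|X|]/Num.norm /= mx_normrE.
apply: (iffP (bigmax_ltP _ _ _ _)) => [[_ He] i j|He]; first exact: (He (i, j)).
by split=> // -[i j] _; exact: He.
Qed.

Lemma mx_norm_leP m n (X : 'M[R]_(m, n)) e : 0 <= e ->
  reflect (forall i j, `|X i j| <= e) (`|X| <= e).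
Proof.
move=> e0; rewrite [`|X|]/Num.norm /= mx_normrE.
apply: (iffP (bigmax_leP _ _ _ _)) => [[_ He] i j|He]; first exact: (He (i, j)).
by split=> // -[i j] _; exact: He.
Qed.

Lemma le_mx_norm m n (X : 'M[R]_(m, n)) i j : `|X i j| <= `|X|.
Proof. by apply/(mx_norm_leP _ (normr_ge0 X)). Qed.

Lemma mx_norm_mulmx m n p (X : 'M[R]_(m, n)) (Y : 'M[R]_(n, p)) :
  `|X *m Y| <= n%:R * (`|X| * `|Y|).
Proof.
apply/mx_norm_leP => [|i j]; first by rewrite !mulr_ge0.
rewrite mxE (le_trans (ler_norm_sum _ _ _))//.
rewrite -[n in n%:R]card_ord mulr_natl -sumr_const ler_sum // => k _.
by rewrite normrM ler_pM ?le_mx_norm.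
Qed.

Lemma mx_norm_row_mx m n p (X : 'M[R]_(m, n)) (Y : 'M[R]_(m, p)) e :
  (`|row_mx X Y| <= e) = (`|X| <= e) && (`|Y| <= e).
Proof.
have [e0|e0] := leP 0 e; last first.
  by rewrite !(leNgt _ e) !(lt_le_trans e0).
apply/idP/andP => [/(mx_norm_leP _ e0) H|].
  split; apply/(mx_norm_leP _ e0) => i j.
    by rewrite -(row_mxEl X Y).
  by rewrite -(row_mxEr X Y).
move=> [/(mx_norm_leP _ e0) H1 /(mx_norm_leP _ e0) H2].
by apply/(mx_norm_leP _ e0) => i j; rewrite mxE; case: fintype.split.
Qed.

Lemma round_row n (w : 'rV[R]_n) :
  exists m : 'rV[int]_n, `|w - map_mx intr m| <= 1.
Proof.
exists (\row_j Num.floor (w 0 j)); apply/mx_norm_leP => // i j.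
rewrite !mxE ord1; have /andP[] := floor_itv (w 0 j).
by rewrite intrD ler_norml => *; apply/andP; split; lra.
Qed.

Lemma int_row_eq0 n (m : 'rV[int]_n) :
  `|map_mx intr m : 'rV[R]_n| < 1 -> m = 0.
Proof.
move=> /(mx_norm_ltP _ ltr01) H; apply/rowP => j; apply/eqP.
have := H 0 j; rewrite !mxE -intr_norm ltrz1 => m0.
by rewrite -normr_eq0 eq_le normr_ge0 andbT -ltzD1.
Qed.

End MatrixNorm.

(** * Block arithmetic of the matrices [Mx] *)

Section Heisenberg.
Variables (R : realType) (d : nat).
Implicit Types (a b : 'rV[R]_d) (c : 'M[R]_d) (x : R).

Lemma Mx_mul x a b c x' a' b' c' :
  Mx x a b c *m Mx x' a' b' c' =
  Mx (x * x') (x *: a' + a) (b' + x' *: b) (c' + b^T *m a' + c).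
Proof.
rewrite /Mx !mulmx_block !mul1mx !mulmx0 !mul0mx !addr0 !add0r.
rewrite mul_row_block !mulmx0 ?mulmx1 ?addr0 add_row_mx ?mul0mx ?addr0 ?add0r.
rewrite ?mul_scalar_mx ?mul_mx_scalar.
congr block_mx; first congr row_mx.
- by apply/matrixP => i j; rewrite !mxE.
- by apply/matrixP => i j; rewrite !mxE addrA !big_ord1 !mxE.
- by rewrite scale_scalar_mx.
Qed.

Lemma Mx1 : Mx 1 0 0 0 = 1%:M :> 'M[R]_(d + (1 + d)).
Proof.
rewrite /Mx; apply/esym; rewrite scalar_mx_block; congr block_mx.
  by apply/matrixP => i j; rewrite !mxE; case: fintype.split => k; rewrite !mxE.
exact: scalar_mx_block.
Qed.

Lemma Mx_unit_inv x a b c : x != 0 ->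
  Mx x a b c \in unitmx /\
  invmx (Mx x a b c) =
    Mx x^-1 (- (x^-1 *: a)) (- (x^-1 *: b)) (x^-1 *: (b^T *m a) - c).
Proof.
move=> x0; set Y := (X in _ = X).
have XY : Mx x a b c *m Y = 1%:M.
  rewrite Mx_mul mulfV // scalerN scalerA mulfV // scale1r addNr addNr.
  by rewrite mulmxN -scalemxAr [_ - c + _]addrAC subrr sub0r addNr Mx1.
have [Xu _] := mulmx1_unit XY; split => //.
by rewrite -[LHS]mulmx1 -XY mulKmx.
Qed.

Lemma MxEx x a b c : Mx x a b c (rshift _ (lshift _ 0)) (rshift _ (lshift _ 0)) = x.
Proof. by rewrite /Mx block_mxEdr block_mxEul mxE. Qed.

Lemma MxEa x a b c j : Mx x a b c (rshift _ (lshift _ 0)) (rshift _ (rshift _ j)) = a 0 j.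
Proof. by rewrite /Mx block_mxEdr block_mxEur. Qed.

Lemma MxEb x a b c i : Mx x a b c (lshift _ (rev_ord i)) (rshift _ (lshift _ 0)) = b 0 i.
Proof. by rewrite /Mx block_mxEur row_mxEl mxE rev_ordK. Qed.

Lemma MxEc x a b c i j :
  Mx x a b c (lshift _ (rev_ord i)) (rshift _ (rshift _ j)) = c i j.
Proof. by rewrite /Mx block_mxEur row_mxEr mxE rev_ordK. Qed.

(** The norm is the largest absolute entry; the constant blocks cancel in the difference, and the
    row reversal only permutes entries. *)
Lemma Mx_norm_le x a b c x' a' b' c' e :
  (`|Mx x a b c - Mx x' a' b' c'| <= e) =
  [&& `|x - x'| <= e, `|a - a'| <= e, `|b - b'| <= e & `|c - c'| <= e].
Proof.
have [e0|e0] := leP 0 e; last by rewrite !(leNgt _ e) !(lt_le_trans e0).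
apply/idP/and4P => [H|[Hx /(mx_norm_leP _ e0) Ha]].
  have E i j : `|Mx x a b c i j - Mx x' a' b' c' i j| <= e.
    by have := le_trans (le_mx_norm _ i j) H; rewrite !mxE.
  split; last 3 first.
  - by apply/mx_norm_leP => // i j; rewrite !mxE ord1 -(MxEa x a b c) -(MxEa x' a' b' c').
  - by apply/mx_norm_leP => // i j; rewrite !mxE ord1 -(MxEb x a b c) -(MxEb x' a' b' c').
  - by apply/mx_norm_leP => // i j; rewrite !mxE -(MxEc x a b c) -(MxEc x' a' b' c').
  - by rewrite -(MxEx x a b c) -[x'](MxEx x' a' b' c').
move=> /(mx_norm_leP _ e0) Hb /(mx_norm_leP _ e0) Hc.
apply/mx_norm_leP => // i j; rewrite mxE [X in _ + X]mxE /Mx.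
case: (split_ordP i) => {}i ->; case: (split_ordP j) => {}j ->.
- by rewrite !block_mxEul subrr normr0.
- rewrite !block_mxEur; case: (split_ordP j) => {}j ->.
    by rewrite !row_mxEl !mxE; have := Hb 0 (rev_ord i); rewrite !mxE.
  by rewrite !row_mxEr !mxE; have := Hc (rev_ord i) j; rewrite !mxE.
- by rewrite !block_mxEdl subrr normr0.
rewrite !block_mxEdr; case: (split_ordP i) => {}i ->; case: (split_ordP j) => {}j ->.
- by rewrite !block_mxEul !ord1 !mxE.
- by rewrite !block_mxEur; have := Ha i j; rewrite !mxE.
- by rewrite !block_mxEdl subrr normr0.
- by rewrite !block_mxEdr subrr normr0.
Qed.

Lemma Mx_inj x a b c x' a' b' c' : Mx x a b c = Mx x' a' b' c' ->
  [/\ x = x', a = a', b = b' & c = c'].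
Proof.
move=> E; have : `|Mx x a b c - Mx x' a' b' c'| <= 0 by rewrite E subrr normr0.
by rewrite Mx_norm_le !normr_le0 !subr_eq0 => /and4P[/eqP-> /eqP-> /eqP-> /eqP->].
Qed.

End Heisenberg.

(** * Generated matrix groups *)

Section MatrixGroups.
Variables (R : realType) (n : nat).
Implicit Types G S : set 'M[R]_n.

Lemma sub_matrix_group_generated S : S `<=` matrix_group_generated S.
Proof. exact: sub_gen_smallest. Qed.

Lemma matrix_group_generated_sub G S :
  is_matrix_group G -> S `<=` G -> matrix_group_generated S `<=` G.
Proof. exact: smallest_sub. Qed.

(** The ambient group G guarantees that the family being intersected is nonempty, and so makes the
    generated elements invertible. *)
Lemma is_matrix_group_generated G S :
  is_matrix_group G -> S `<=` G -> is_matrix_group (matrix_group_generated S).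
Proof.
move=> gG SG; split.
- by move=> x; move=> /(matrix_group_generated_sub gG SG); case: gG => + _ _ _; exact.
- by move=> H [] [].
- by move=> x y Sx Sy H [gH SH]; case: (gH) => _ _ + _; apply; [apply: Sx|apply: Sy].
- by move=> x Sx H [gH SH]; case: (gH) => _ _ _; apply; apply: Sx.
Qed.

End MatrixGroups.

(** * The quadratic correction in ordered products *)

Section OrderedQuadraticForm.
Variables (R : realType) (n : nat).
Implicit Types x y p q : 'I_n -> R.

(** For p = [B i] and q = [A j], this is what the products of b and a blocks add to entry (i, j) of
    the central block of g_1^(x_1) ... g_(2d)^(x_(2d)): the first sum comes from each power, the
    second from pairs s < t. With x a row of N it is an entry of [f_mx]. *)
Definition ordered_quad x p q : R :=
  \sum_s x s * (x s - 1) / 2 * p s * q s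
  + \sum_(s < n) \sum_(t < n | (s < t)%N) x s * x t * p s * q t.

Lemma sum_triangular (F : 'I_n -> 'I_n -> R) :
  \sum_s \sum_t F s t =
  \sum_s F s s + \sum_(s < n) \sum_(t < n | (s < t)%N) (F s t + F t s).
Proof.
under [X in _ = _ + X]eq_bigr do rewrite big_split /=.
rewrite big_split /=; have -> : \sum_(s < n) \sum_(t < n | (s < t)%N) F t s =
    \sum_(s < n) \sum_(t < n | (t < s)%N) F s t.
  by rewrite (exchange_big_dep predT).
rewrite addrA -!big_split /=.
apply: eq_bigr => s _; rewrite (bigD1 s) //= -addrA; congr (_ + _).
rewrite (bigID (fun t : 'I_n => (s < t)%N)) /=; congr (_ + _); apply: eq_bigl => t.
  by rewrite andbC; case: ltngtP => //= st; apply/eqP => E; rewrite E ltnn in st.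
by rewrite -leqNgt ltn_neqAle.
Qed.

(** The product of sums is the b(x) a(y) term of multiplying two ordered products; the last sum is
    the cost of sorting the factors, with entries of e^{s,t} as coefficients. *)
Lemma ordered_quadD x y p q :
  ordered_quad (fun s => x s + y s) p q =
  ordered_quad x p q + ordered_quad y p q
  + (\sum_s x s * p s) * (\sum_t y t * q t)
  + \sum_(s < n) \sum_(t < n | (s < t)%N) y s * x t * (p s * q t - q s * p t).
Proof.
have diag : \sum_s (x s + y s) * (x s + y s - 1) / 2 * p s * q s =
    \sum_s x s * (x s - 1) / 2 * p s * q s
    + \sum_s y s * (y s - 1) / 2 * p s * q s
    + \sum_s x s * p s * (y s * q s).
  by rewrite -!big_split; apply: eq_bigr => s _ /=; field.
have tri : \sum_(s < n) \sum_(t < n | (s < t)%N)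
      (x s + y s) * (x t + y t) * p s * q t =
    \sum_(s < n) \sum_(t < n | (s < t)%N) x s * x t * p s * q t
    + \sum_(s < n) \sum_(t < n | (s < t)%N) y s * y t * p s * q t
    + \sum_(s < n) \sum_(t < n | (s < t)%N)
        (x s * p s * (y t * q t) + x t * p t * (y s * q s))
    + \sum_(s < n) \sum_(t < n | (s < t)%N) y s * x t * (p s * q t - q s * p t).
  rewrite -!big_split; apply: eq_bigr => s _ /=.
  by rewrite -!big_split; apply: eq_bigr => t _ /=; ring.
by rewrite big_distrlr /= sum_triangular /ordered_quad diag tri; ring.
Qed.

End OrderedQuadraticForm.

(** * Induction on integer rows, and integer combinations of columns *)

Lemma int_scale_ind (V : lmodType int) (S : V -> Prop) (v : V) (z : int) :
  S 0 -> (forall u w, S u -> S w -> S (u + w)) -> (forall u, S u -> S (- u)) ->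
  S v -> S (z *: v).
Proof.
move=> S0 SD SN Sv.
have Sn n : S (v *+ n) by elim: n => [|n IH] //; rewrite mulrS; exact: SD.
rewrite -[z]intz scaler_int; case: z => n; first exact: Sn.
by rewrite NegzE mulrNz; apply: SN; exact: Sn.
Qed.

Lemma int_row_ind n (S : 'rV[int]_n -> Prop) :
  S 0 -> (forall u w, S u -> S w -> S (u + w)) -> (forall u, S u -> S (- u)) ->
  (forall k, S (delta_mx 0 k)) -> forall m, S m.
Proof.
move=> S0 SD SN Sdelta m; rewrite [m]row_sum_delta.
by elim/big_ind: _ => // k _; exact: int_scale_ind.
Qed.

Section IntegerCombinations.
Variables (R : realType) (d n : nat) (V : 'M[R]_(d, n)).
Implicit Types m : 'rV[int]_n.

(** This is a(m) for V = A and b(m) for V = B. *)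
Definition int_comb m : 'rV[R]_d := map_mx intr m *m V^T.

Lemma int_combD m m' : int_comb (m + m') = int_comb m + int_comb m'.
Proof. by rewrite /int_comb map_mxD mulmxDl. Qed.

Lemma int_combN m : int_comb (- m) = - int_comb m.
Proof. by rewrite /int_comb map_mxN mulNmx. Qed.

Lemma int_comb0 : int_comb 0 = 0.
Proof. by rewrite /int_comb map_mx0 mul0mx. Qed.

Lemma int_comb_delta k : int_comb (delta_mx 0 k) = (col k V)^T.
Proof. by rewrite /int_comb map_delta_mx -rowE tr_col. Qed.

Lemma int_comb_sum m i : int_comb m 0 i = \sum_s (m 0 s)%:~R * V i s.
Proof. by rewrite mxE; apply: eq_bigr => s _; rewrite !mxE. Qed.

Lemma int_comb_eigen (N : 'M[int]_n) x m : map_mx intr N *m V^T = x *: V^T ->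
  int_comb (m *m N) = x *: int_comb m.
Proof. by move=> E; rewrite /int_comb map_mxM -mulmxA E scalemxAr. Qed.

End IntegerCombinations.

(** * Integer combinations inside an additive subgroup *)

Section CentralSubgroup.
Variables (R : realType) (d : nat) (K : set 'M[R]_d).
Hypotheses (K0 : K 0) (KD : forall u v, K u -> K v -> K (u + v))
  (KN : forall u, K u -> K (- u)).

Lemma subgroup_int u (z : int) : K u -> K (z%:~R *: u).
Proof.
move=> Ku; have Kn n : K (u *+ n) by elim: n => [|n IH] //; rewrite mulrS; exact: KD.
rewrite scaler_int; case: z => n; first exact: Kn.
by rewrite NegzE mulrNz; apply: KN; exact: Kn.
Qed.

Lemma subgroup_sum (I : Type) (r : seq I) (Q : pred I) (F : I -> 'M[R]_d) :
  (forall i, Q i -> K (F i)) -> K (\sum_(i <- r | Q i) F i).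
Proof. by move=> KF; elim/big_ind: _. Qed.

End CentralSubgroup.

(** * The explicit group containing Lambda *)

Section UnipotentLattice.
Variables (R : realType) (d : nat) (alpha : R) (N : 'M[int]_(2 * d)).
Variables (A B : 'M[R]_(d, 2 * d)) (C : 'I_(2 * d) -> 'M[R]_d).
Variable (K : set 'M[R]_d).
Implicit Types m : 'rV[int]_(2 * d).

(* The central block of the ordered product g_1^(m_1) ... g_(2d)^(m_(2d)). *)
Definition gamma m : 'M[R]_d := \matrix_(i, j)
  (\sum_s (m 0 s)%:~R * C s i j
   + ordered_quad (fun s => (m 0 s)%:~R) (B i) (A j)).

Hypothesis alpha0 : alpha != 0.
Hypothesis N_unit : N \in unitmx.
Hypothesis A_eigen : map_mx intr N *m A^T = alpha *: A^T.
Hypothesis B_eigen : map_mx intr N *m B^T = alpha^-1 *: B^T.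
Hypotheses (K0 : K 0) (KD : forall u v, K u -> K v -> K (u + v))
  (KN : forall u, K u -> K (- u)).
Hypothesis K_comm : forall s t, K (e_mx A B s t).
Hypothesis gamma_row : forall k, K (gamma (row k N) - C k).

Local Ltac mx_abelian :=
  repeat match goal with
  | |- context [gamma ?m] => move: (gamma m) => ?
  | |- context [?X *m ?Y] => move: (X *m Y) => ?
  end; apply/matrixP => ? ?; rewrite !mxE; ring.

Lemma mul_tr_scale x y (b a : 'rV[R]_d) :
  (x *: b)^T *m (y *: a) = (x * y) *: (b^T *m a).
Proof. by rewrite -scalemxAr [(x *: b)^T]linearZ -scalemxAl scalerA mulrC. Qed.

(** The part linear in C is additive, so by [ordered_quadD] only an integer combination of the
    e^{s,t} remains. *)
Lemma gammaD m m' : K (gamma (m + m') - gamma m - gamma m' -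
  (int_comb B m)^T *m int_comb A m').
Proof.
suff -> : gamma (m + m') - gamma m - gamma m' - (int_comb B m)^T *m int_comb A m' =
    \sum_(s < 2 * d) \sum_(t < 2 * d | (s < t)%N)
      (m' 0 s * m 0 t)%:~R *: e_mx A B s t.
  do 2!apply: subgroup_sum => // ? _.
  exact: subgroup_int.
apply/matrixP => i j; rewrite summxE.
under [RHS]eq_bigr do rewrite summxE.
rewrite !mxE big_ord1 mxE !int_comb_sum.
have -> : ordered_quad (fun s => ((m + m') 0 s)%:~R) (B i) (A j) =
    ordered_quad (fun s => (m 0 s)%:~R + (m' 0 s)%:~R) (B i) (A j).
  by congr ordered_quad; apply/funext => s; rewrite mxE intrD.
rewrite ordered_quadD.
have -> : \sum_s ((m + m') 0 s)%:~R * C s i j =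
    \sum_s (m 0 s)%:~R * C s i j + \sum_s (m' 0 s)%:~R * C s i j.
  by rewrite -big_split; apply: eq_bigr => s _; rewrite mxE intrD mulrDl.
have -> : \sum_(s < 2 * d) \sum_(t < 2 * d | (s < t)%N)
     ((m' 0 s * m 0 t)%:~R *: e_mx A B s t) i j =
   \sum_(s < 2 * d) \sum_(t < 2 * d | (s < t)%N)
     (m' 0 s)%:~R * (m 0 t)%:~R * (B i s * A j t - A j s * B i t).
  by do 2!apply: eq_bigr => ? _; rewrite !mxE intrM.
ring.
Qed.

Lemma gamma0 : K (gamma 0).
Proof.
have := gammaD 0 0; rewrite addr0 !int_comb0 mulmx0 subr0 subrr sub0r.
by move/KN; rewrite opprK.
Qed.

Lemma gammaN m :
  K (gamma (- m) + gamma m - (int_comb B m)^T *m int_comb A m).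
Proof.
have := KD gamma0 (KN (gammaD m (- m))); rewrite subrr int_combN mulmxN.
by congr (K _); mx_abelian.
Qed.

(** The ordered product is g_k alone: x(x-1)/2 vanishes for x = 0 and x = 1, and no two distinct
    coordinates are nonzero. *)
Lemma gamma_delta k : gamma (delta_mx 0 k) = C k.
Proof.
apply/matrixP => i j; rewrite mxE /ordered_quad (bigD1 k) //= mxE !eqxx mul1r.
rewrite big1 ?addr0 => [|s sk]; last by rewrite mxE (negPf sk) andbF mulr0z mul0r.
rewrite big1 ?add0r => [|s _]; last first.
  by rewrite mxE eqxx; case: eqP => _ /=; rewrite ?mulr1z ?mulr0z ?subrr; ring.
rewrite big1 ?addr0 // => s _; rewrite big1 // => t st; rewrite !mxE !eqxx.
by case: eqP st => [->|_]; case: eqP => [->|_]; rewrite ?ltnn //= ?mulr0z => _; ring.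
Qed.

Lemma gamma_mulN m : K (gamma (m *m N) - gamma m).
Proof.
pose phi m := gamma (m *m N) - gamma m.
have phiD u w : K (phi (u + w) - phi u - phi w).
  have := KD (gammaD (u *m N) (w *m N)) (KN (gammaD u w)).
  (* The factors 1/alpha and alpha cancel in b(uN) a(wN), so both product terms agree and phi is
     additive modulo K. *)
  rewrite -mulmxDl !(int_comb_eigen _ A_eigen) !(int_comb_eigen _ B_eigen).
  rewrite mul_tr_scale mulVf // scale1r.
  by rewrite /phi; congr (K _); mx_abelian.
have phi0 : K (phi 0) by rewrite /phi mul0mx subrr.
(* On unit vectors the claim is [gamma_row], the linear system for C read modulo K. *)
have phi_delta k : K (phi (delta_mx 0 k)).
  by rewrite /phi -rowE gamma_delta.
rewrite -/(phi m); move: phi phiD phi0 phi_delta => phi phiD phi0 phi_delta.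
have phi_add u w : K (phi u) -> K (phi w) -> K (phi (u + w)).
  by move=> Ku Kw; have := KD (phiD u w) (KD Ku Kw); congr (K _); mx_abelian.
elim/(@int_row_ind (2 * d)): m => // u Ku.
have := KN (KD (phiD u (- u)) Ku); rewrite subrr => /(KD phi0).
by congr (K _); mx_abelian.
Qed.

Lemma gamma_shift (n : int) m : exists m1,
  [/\ int_comb A m1 = alpha ^ n *: int_comb A m,
      int_comb B m1 = alpha ^ (- n) *: int_comb B m
    & K (gamma m1 - gamma m)].
Proof.
elim/int_rect: n => [|n [m1 [A1 B1 K1]]|n [m1 [A1 B1 K1]]].
- by exists m; rewrite oppr0 !expr0z !scale1r subrr.
- exists (m1 *m N); rewrite (int_comb_eigen _ A_eigen) (int_comb_eigen _ B_eigen).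
  rewrite A1 B1 !scalerA intS opprD !expfzDr // -[alpha ^ (-1)]/(alpha^-1) expr1z.
  by split=> //; have := KD (gamma_mulN m1) K1; congr (K _); mx_abelian.
have [w E] : exists w, m1 = w *m N by exists (m1 *m invmx N); rewrite mulmxKV.
rewrite opprK in B1; move: A1 B1 K1; rewrite E => A1 B1 K1.
exists w; rewrite opprK intS opprD !expfzDr // -!scalerA.
rewrite -[alpha ^ (-1)]/(alpha^-1) expr1z -A1 -B1.
rewrite (int_comb_eigen _ A_eigen) (int_comb_eigen _ B_eigen) !scalerA.
rewrite mulVf // mulfV // !scale1r; split=> //.
by have := KD (KN (gamma_mulN w)) K1; congr (K _); mx_abelian.
Qed.

(** The element displayed is g_0^n M(1, a(m), b(m), c), whence the factor alpha^n on the a block. *)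
Definition Lambda_model : set 'M[R]_(d + (1 + d)) :=
  [set X | exists (n : int) m c, K (c - gamma m) /\
    X = Mx (alpha ^ n) (alpha ^ n *: int_comb A m) (int_comb B m) c].

Lemma Lambda_model_group : is_matrix_group Lambda_model.
Proof.
have alphaX n : alpha ^ n != 0 by rewrite expfz_neq0.
split.
- move=> _ [n [m [c [_ ->]]]].
  exact: (Mx_unit_inv (alpha ^ n *: int_comb A m) (int_comb B m) c (alphaX n)).1.
- exists 0, 0, 0; rewrite !int_comb0 scaler0 Mx1 sub0r; split=> //.
  exact/KN/gamma0.
- move=> _ _ [n [m [c [Kc ->]]]] [n' [m' [c' [Kc' ->]]]].
  (* Moving g_0^(n') to the left past the unipotent factor of the first element replaces m by m1. *)
  have [m1 [A1 B1 K1]] := gamma_shift (- n') m; rewrite opprK in B1.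
  exists (n + n'), (m1 + m'), (c' + (int_comb B m)^T *m (alpha ^ n' *: int_comb A m') + c).
  rewrite Mx_mul !int_combD A1 B1 !expfzDr //; split; last first.
    congr Mx; last by rewrite addrC.
    by rewrite -invr_expz scalerDr !scalerA mulfK // addrC.
  have := KD (KN (gammaD m1 m')) (KD (KD Kc Kc') (KN K1)).
  rewrite B1 [(alpha ^ n' *: _)^T]linearZ -scalemxAl -scalemxAr.
  by congr (K _); mx_abelian.
move=> _ [n [m [c [Kc ->]]]].
(* The inverse of g_0^n u is g_0^(-n) (g_0^n u^(-1) g_0^(-n)), which calls for the shift by n. *)
have [m1 [A1 B1 K1]] := gamma_shift n m.
case: (Mx_unit_inv (alpha ^ n *: int_comb A m) (int_comb B m) c (alphaX n)) => _ ->.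
exists (- n), (- m1), ((int_comb B m)^T *m int_comb A m - c).
rewrite -!invr_expz !int_combN A1 B1 -invr_expz -scalemxAr !scalerA mulVf // !scale1r.
split; last by rewrite scalerN scalerA mulVf // scale1r.
have := KD (KN (gammaN m1)) (KD K1 (KN Kc)).
rewrite A1 B1 -invr_expz mul_tr_scale mulVf // scale1r.
by congr (K _); mx_abelian.
Qed.

End UnipotentLattice.

(** * Discreteness in terms of the norm *)

Lemma isolated_eqP (R : realType) (n : nat) (L : set 'M[R]_n) :
  isolated L = L <->
  forall x, L x -> exists2 e, 0 < e & forall y, L y -> `|x - y| <= e -> x = y.
Proof.
split=> [isoL x Lx|isoL].
- have [_ [V xV VL]] : isolated L x by rewrite isoL.
  have [e e0 eV] := (nbhs_ballP _ _).1 xV.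
  (* Halving the radius passes from an open ball to a closed one. *)
  exists (e / 2) => [|y Ly xy]; first by rewrite divr_gt0.
  suff : [set x] y by move=> ->.
  rewrite -VL; split=> //; apply: eV; rewrite mx_norm_ball /ball_ /=.
  by rewrite (le_lt_trans xy) // ltr_pdivrMr // ltr_pMr // ltr1n.
apply/seteqP; split=> [|x Lx]; first exact: isolatedS.
split; first exact: mem_set.
have [e e0 eL] := isoL x Lx; exists (ball x e); first exact: nbhsx_ballx.
apply/seteqP; split=> [y [xy Ly]|_ -> /=]; last by split=> //; exact: ballxx.
apply/esym/eL => //; move: xy; rewrite mx_norm_ball; exact: ltW.
Qed.

(** * Spacing of the powers of alpha *)

Section Powers.
Variables (R : realType) (alpha : R).
Hypothesis alpha_gt1 : 1 < alpha.

Let alpha_gt0 : 0 < alpha. Proof. by rewrite (lt_trans _ alpha_gt1). Qed.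

(** The bound is the distance from alpha^n to its nearest neighbour among the powers,
    alpha^(n-1). *)
Lemma expz_isolated n n' :
  `|alpha ^ n - alpha ^ n'| < alpha ^ n * (1 - alpha^-1) -> n = n'.
Proof.
have le1 := ltW alpha_gt1; have aN : alpha ^ (-1) = alpha^-1 by [].
have an0 : 0 < alpha ^ n by rewrite exprz_gt0.
have a1 : 0 < alpha^-1 by rewrite invr_gt0.
case: (ltgtP n n') => // [nn'|n'n]; rewrite mulrBr mulr1.
- have : alpha ^ (n + 1) <= alpha ^ n' by rewrite ler_eXz2l // lezD1.
  rewrite expfzDr ?gt_eqF // expr1z distrC => H /ltr_normlW H'.
  (* The gap above alpha^n is at least the gap below it, since alpha + 1/alpha >= 2. *)
  have : 0 <= alpha ^ n * (alpha^-1 + alpha - 2).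
    rewrite mulr_ge0 ?(ltW an0) //.
    have -> : alpha^-1 + alpha - 2 = alpha^-1 * (alpha - 1) ^+ 2.
      by field; rewrite gt_eqF.
    by rewrite mulr_ge0 ?sqr_ge0 // ltW.
  move: H H'; move: (alpha ^ n) (alpha ^ n') alpha^-1 => p q a H1 H2 H3.
  by exfalso; clear -H1 H2 H3; lra.
- have : alpha ^ n' <= alpha ^ (n - 1) by rewrite ler_eXz2l // lerBrDr lezD1.
  by rewrite expfzDr ?gt_eqF // aN => H /ltr_normlW H'; exfalso; clear -H H'; lra.
Qed.

Lemma expz_scale x : 0 < x -> exists n : int, 1 <= x * alpha ^ n <= alpha.
Proof.
move=> x0; have lna : 0 < ln alpha by rewrite ln_gt0.
pose n := Num.floor (ln x / ln alpha); exists (- n).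
have [] := andP (floor_itv (ln x / ln alpha)); rewrite -/n.
rewrite ler_pdivlMr // ltr_pdivrMr // intrD mulrDl mul1r => H1 H2.
have aE : alpha ^ (- n) = expR (- (n%:~R * ln alpha)).
  by rewrite -powR_intmul ?(ltW alpha_gt0) // /powR gt_eqF // mulrNz mulNr.
have xE : x * alpha ^ (- n) = expR (ln x - n%:~R * ln alpha).
  by rewrite aE expRD lnK ?posrE.
rewrite xE -[X in (X <= _) && _]expR0 ler_expR -[X in _ && X]ler_ln ?posrE ?expR_gt0 // expRK.
by clear -H1 H2; apply/andP; split; lra.
Qed.

End Powers.

(** * Cocompactness of K among all d x d matrices *)

Section CocompactCenter.
Variables (R : realType) (d : nat) (A B : 'M[R]_(d, 2 * d)) (Q : 'M[R]_(d + d, 2 * d)).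
Hypothesis QV : Q *m row_mx A^T B^T = 1%:M.
Variable K : set 'M[R]_d.
Hypotheses (K0 : K 0) (KD : forall u v, K u -> K v -> K (u + v))
  (KN : forall u, K u -> K (- u)).
Hypothesis K_comm : forall s t, K (e_mx A B s t).

Lemma e_mx_comb (U : 'M[R]_(2 * d)) :
  \sum_s \sum_t U s t *: e_mx A B s t = B *m U *m A^T - (A *m U *m B^T)^T.
Proof.
apply/matrixP => i j; rewrite summxE !mxE.
under eq_bigr do rewrite summxE.
rewrite exchange_big -sumrB; apply: eq_bigr => t _.
rewrite !mxE !mulr_suml -sumrB; apply: eq_bigr => s _.
by rewrite !mxE; ring.
Qed.

(* With Q the column of blocks Y, X, row i of X gives real coefficients whose
   combination of the (a^k, b^k) is (0, delta_i), and row j of Y one that is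
   (delta_j, 0); the commutator of the two is the matrix unit at (i, j). *)
Lemma e_mx_span c : exists U : 'M[R]_(2 * d), c = \sum_s \sum_t U s t *: e_mx A B s t.
Proof.
move: QV; rewrite -[Q]vsubmxK mul_col_row scalar_mx_block => /eq_block_mx.
set Y := usubmx Q; set X := dsubmx Q => -[YA _ XA XB].
exists (X^T *m c *m Y); rewrite e_mx_comb.
have -> : B *m (X^T *m c *m Y) *m A^T = (X *m B^T)^T *m c *m (Y *m A^T).
  by rewrite trmx_mul trmxK !mulmxA.
have -> : A *m (X^T *m c *m Y) *m B^T = (X *m A^T)^T *m c *m (Y *m B^T).
  by rewrite trmx_mul trmxK !mulmxA.
by rewrite XA XB YA trmx0 trmx1 !mul0mx trmx0 subr0 mul1mx mulmx1.
Qed.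

(** Rounding down the coefficients from [e_mx_span] changes c by an element of K and leaves
    coefficients in [0, 1). *)
Lemma center_cobounded : exists r : R, forall c, exists2 k, K k & `|c + k| <= r.
Proof.
exists (\sum_s \sum_t `|e_mx A B s t|) => c; have [U ->] := e_mx_span c.
exists (\sum_s \sum_t (- Num.floor (U s t))%:~R *: e_mx A B s t).
  by do 2!apply: subgroup_sum => // ? _; exact: subgroup_int.
rewrite -big_split /= (le_trans (ler_norm_sum _ _ _)) // ler_sum // => s _.
rewrite -big_split /= (le_trans (ler_norm_sum _ _ _)) // ler_sum // => t _.
rewrite -scalerDl normrZ ler_piMl // mulrNz.
by have := floor_itv (U s t); rewrite intrD ler_norml => /andP[? ?]; apply/andP; split; lra.
Qed.

End CocompactCenter.

(** * The basis formed by the two eigenbases of N *)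

Section Eigenbases.
Variables (R : realType) (d : nat) (N : 'M[int]_(2 * d)).

Lemma eigenbasis_mul x (V : 'M[R]_(d, 2 * d)) : is_eigenbasis N x V ->
  map_mx intr N *m V^T = x *: V^T.
Proof.
case=> _ /eqmxP VE; have /eigenspaceP E : (V <= eigenspace (intmx_to_real R N)^T x)%MS.
  by rewrite VE.
by apply: trmx_inj; rewrite trmx_mul trmxK E linearZ /= trmxK.
Qed.

(** Eigenspaces for distinct eigenvalues meet trivially, so the 2d stacked rows are independent. As
    d + d and 2 * d are distinct as index bounds, invertibility is stated by a two-sided inverse
    Q. *)
Lemma eigenbases_basis x y (A B : 'M[R]_(d, 2 * d)) : x != y ->
  is_eigenbasis N x A -> is_eigenbasis N y B ->
  exists Q : 'M[R]_(d + d, 2 * d),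
    Q *m row_mx A^T B^T = 1%:M /\ row_mx A^T B^T *m Q = 1%:M.
Proof.
move=> xy [Afree /eqmxP AE] [Bfree /eqmxP BE].
have AB0 : (A :&: B = 0)%MS.
  apply/eqP; rewrite -submx0; apply/row_subP => i.
  set v := row i _; have : (v <= A :&: B)%MS by exact: row_sub.
  rewrite sub_capmx AE BE => /andP[/eigenspaceP vx /eigenspaceP vy].
  rewrite submx0; have : (x - y) *: v == 0 by rewrite scalerBl -vx -vy subrr.
  by rewrite scaler_eq0 subr_eq0 (negPf xy).
have rk : \rank (col_mx A B) = (d + d)%N.
  by rewrite -addsmxE mxrank_disjoint_sum // (eqP Afree) (eqP Bfree).
have Vfree : row_free (col_mx A B) by rewrite /row_free rk.
have Vfull : row_full (col_mx A B) by rewrite /row_full rk mul2n -addnn.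
exists (pinvmx (col_mx A B))^T; rewrite -tr_col_mx -!trmx_mul.
by rewrite mulmxVp // mulVpmx // !trmx1.
Qed.

End Eigenbases.

(** * Compactness of the quotient from bounded representatives *)

Section CosetSpaceCompact.
Variables (R : realType) (d : nat).
Local Notation params := 'rV[R]_(1 + (d + (d + d * d))).

(* The scalar 1 + |p_0| keeps the value inside G for every p. *)
Definition Mx_param (p : params) : 'M[R]_(d + (1 + d)) :=
  Mx (1 + `|p 0 (lshift _ 0)|) (lsubmx (rsubmx p))
    (lsubmx (rsubmx (rsubmx p))) (vec_mx (rsubmx (rsubmx (rsubmx p)))).

Lemma Mx_param_groupG p : Mx_param p \in @groupG R d.
Proof.
by apply/mem_set; do 4 eexists; split; last by []; rewrite ltr_wpDr.
Qed.

Lemma Mx_param_lipschitz p q : `|Mx_param p - Mx_param q| <= `|p - q|.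
Proof.
have E j : `|p 0 j - q 0 j| <= `|p - q|.
  by have := le_mx_norm (p - q) 0 j; rewrite !mxE.
rewrite Mx_norm_le; apply/and4P; split.
- by rewrite opprD addrACA subrr add0r (le_trans (ler_dist_dist _ _)).
- by apply/mx_norm_leP => // i j; rewrite !mxE ord1.
- by apply/mx_norm_leP => // i j; rewrite !mxE ord1.
- by apply/mx_norm_leP => // i j; rewrite !mxE.
Qed.

Lemma Mx_param_onto x a b c r : 1 <= x -> x <= r -> `|a| <= r -> `|b| <= r -> `|c| <= r ->
  exists2 p, `|p| <= r & Mx_param p = Mx x a b c.
Proof.
move=> x1 xr ar br cr.
(* Since x - 1 >= 0, the absolute value in [Mx_param] has no effect at this point. *)
exists (row_mx (x - 1)%:M (row_mx a (row_mx b (mxvec c)))).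
  rewrite !mx_norm_row_mx ar br /=; have r0 : 0 <= r by lra.
  apply/andP; split; apply/mx_norm_leP => // i j.
    by rewrite !ord1 mxE eqxx mulr1n ger0_norm ?subr_ge0 //; lra.
  by case/mxvec_indexP: j => k l; rewrite ord1 mxvecE (le_trans (le_mx_norm _ _ _)).
rewrite /Mx_param row_mxEl !row_mxKr !row_mxKl mxvecK mxE mulr1n ger0_norm ?subr_ge0 //.
by rewrite addrC subrK.
Qed.

Definition groupG_param (p : params) : @groupG R d :=
  SigSub (Mx_param_groupG p).

(** G has the initial topology of its inclusion, so continuity is tested on matrices, where the map
    is 1-Lipschitz. *)
Lemma groupG_param_continuous : continuous groupG_param.
Proof.
apply: continuous_comp_initial => p.
have FF : Filter (nbhs p) := nbhs_filter p.
apply/(@cvgrPdist_le _ _ _ _ FF) => e e0.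
apply: filterS (nbhsx_ballx p e e0) => q; rewrite mx_norm_ball /ball_ /= => pq.
exact: le_trans (Mx_param_lipschitz p q) (ltW pq).
Qed.

(** The closed ball of radius r in the parameter space is compact, and the hypothesis makes its
    continuous image in the quotient everything. *)
Lemma coset_space_compact (L : set 'M[R]_(d + (1 + d))) r :
  is_matrix_group L ->
  (forall X, @groupG R d X -> exists l x a b c,
    [/\ L l, X *m l = Mx x a b c, 1 <= x <= r &
        [/\ `|a| <= r, `|b| <= r & `|c| <= r]]) ->
  compact [set: coset_space (@groupG R d) L].
Proof.
move=> [Lu L1 LM LV] HL.
pose pr := (\pi_(coset_space (@groupG R d) L))%qT.
have ball_compact : compact [set p : params | `|p| <= r].
  apply: bounded_closed_compact.
    exists r; split; first exact: num_real.
    by move=> M rM p /= pr0; exact: ltW (le_lt_trans pr0 rM).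
  have := @closed_comp _ _ (@Num.norm _ params) [set x : R | x <= r].
  apply; last exact: closed_le.
  by move=> x _; exact: norm_continuous.
have cont : continuous (pr \o groupG_param : params -> coset_space (@groupG R d) L).
  by move=> p; apply: continuous_comp; [exact: groupG_param_continuous|exact: pi_continuous].
have := continuous_compact (continuous_subspaceT cont) ball_compact.
congr compact; apply/seteqP; split=> // y _.
have [l [x [a [b [c [Ll E /andP[x1 xr] [ar br cr]]]]]]] := HL _ (set_valP (repr y)).
have [p pr0 pE] := Mx_param_onto x1 xr ar br cr.
exists p => //=; rewrite -[RHS]reprK; apply/eqmodP/asboolP.
rewrite /= pE -E; apply/seteqP; split=> _ [u Lu' <-].
  by exists (l *m u); [exact: LM|rewrite mulmxA].
exists (invmx l *m u); first by apply: LM => //; exact: LV.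
by rewrite mulmxA mulmxK // Lu.
Qed.

End CosetSpaceCompact.

(** * Discreteness and bounded coset representatives *)

Section LatticeProperties.
Variables (R : realType) (d : nat) (alpha : R).
Variables (A B : 'M[R]_(d, 2 * d)) (Q : 'M[R]_(d + d, 2 * d)).
Variable K : set 'M[R]_d.
Hypothesis alpha_gt1 : 1 < alpha.
Hypotheses (K0 : K 0) (KD : forall u v, K u -> K v -> K (u + v))
  (KN : forall u, K u -> K (- u)).

Let alpha_gt0 : 0 < alpha. Proof. by rewrite (lt_trans _ alpha_gt1). Qed.

Lemma row_mx_int_comb m :
  row_mx (int_comb A m) (int_comb B m) = map_mx intr m *m row_mx A^T B^T.
Proof. by rewrite mul_mx_row. Qed.

(** Q recovers m from (a(m), b(m)) and enlarges norms at most by the factor q; as q / (1 + q) < 1,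
    the integer row m must vanish. *)
Lemma int_comb_discrete : row_mx A^T B^T *m Q = 1%:M ->
  exists2 e, 0 < e & forall m, `|int_comb A m| <= e -> `|int_comb B m| <= e -> m = 0.
Proof.
move=> VQ; pose q := (d + d)%:R * `|Q|.
have q0 : 0 <= q by rewrite mulr_ge0.
exists (1 + q)^-1 => [|m Am Bm]; first by rewrite invr_gt0; lra.
apply: (@int_row_eq0 R); rewrite -[map_mx _ _]mulmx1 -VQ mulmxA -row_mx_int_comb.
rewrite (le_lt_trans (mx_norm_mulmx _ _)) // mulrCA -/q.
rewrite (@le_lt_trans _ _ ((1 + q)^-1 * q)) //.
  by rewrite ler_wpM2r // mx_norm_row_mx Am Bm.
by rewrite mulrC ltr_pdivrMr; lra.
Qed.

Lemma Lambda_model_discrete (C : 'I_(2 * d) -> 'M[R]_d) :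
  row_mx A^T B^T *m Q = 1%:M ->
  (exists2 e, 0 < e & forall c, K c -> `|c| <= e -> c = 0) ->
  forall x, Lambda_model alpha A B C K x ->
  exists2 e, 0 < e &
    forall y, Lambda_model alpha A B C K y -> `|x - y| <= e -> x = y.
Proof.
move=> VQ [eK eK0 discK] _ [n [m [c [Kc ->]]]].
have [e1 e10 disc1] := int_comb_discrete VQ.
have an0 : 0 < alpha ^ n by rewrite exprz_gt0.
pose e2 := alpha ^ n * (1 - alpha^-1) / 2.
have e20 : 0 < e2 by rewrite divr_gt0 // mulr_gt0 // subr_gt0 invf_lt1.
(* The four radii separate, in turn, elements of K, the b blocks, the powers of alpha, and the a
   blocks, which carry the factor alpha^n. *)
pose e := Num.min (Num.min eK e1) (Num.min e2 (alpha ^ n * e1)).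
have [eleK ele1 ele2 ele3] : [/\ e <= eK, e <= e1, e <= e2 & e <= alpha ^ n * e1].
  by split; rewrite /e !ge_min lexx ?orbT.
exists e => [|_ [n' [m' [c' [Kc' ->]]]]].
  by rewrite /e !lt_min eK0 e10 e20 mulr_gt0.
rewrite Mx_norm_le => /and4P[xe ae be ce].
have nn : n = n'.
  apply: (expz_isolated alpha_gt1).
  rewrite (le_lt_trans (le_trans xe ele2)) // ltr_pdivrMr // ltr_pMr ?ltr1n //.
  by rewrite mulr_gt0 // subr_gt0 invf_lt1.
rewrite -nn in ae *.
have mm : m = m'.
  apply/subr0_eq/disc1; rewrite int_combD int_combN; last exact: le_trans be ele1.
  rewrite -scalerBr normrZ gtr0_norm // in ae.
  by rewrite -(ler_pM2l an0) (le_trans ae).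
rewrite -mm in Kc' *.
suff -> : c = c' by [].
apply/subr0_eq/discK; last exact: le_trans ce eleK.
have := KD Kc (KN Kc'); congr (K _).
by rewrite opprB addrA subrK.
Qed.

Lemma groupG_cobounded (L : set 'M[R]_(d + (1 + d))) :
  Q *m row_mx A^T B^T = 1%:M -> (forall s t, K (e_mx A B s t)) ->
  is_matrix_group L -> L (g0 d alpha) ->
  (forall m, exists c, L (Mx 1 (int_comb A m) (int_comb B m) c)) ->
  (forall c, K c -> L (Mx 1 0 0 c)) ->
  exists r, forall X, @groupG R d X -> exists l x a b c,
    [/\ L l, X *m l = Mx x a b c, 1 <= x <= r &
        [/\ `|a| <= r, `|b| <= r & `|c| <= r]].
Proof.
move=> QV K_comm [_ L1 LM LV] Lg0 LAB LK.
have [r0 Hr0] := center_cobounded QV K0 KD KN K_comm.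
have r0_ge0 : 0 <= r0 by have [k _] := Hr0 0; apply: le_trans.
have Lpow (n : int) : L (Mx (alpha ^ n) 0 0 0).
  have g0V : L (Mx alpha^-1 0 0 0).
    have := LV _ Lg0; rewrite (Mx_unit_inv 0 0 0 (lt0r_neq0 alpha_gt0)).2.
    by rewrite !scaler0 mulmx0 scaler0 !oppr0 addr0.
  elim/int_rect: n => [|n IH|n IH]; first by rewrite expr0z Mx1.
  - have := LM _ _ Lg0 IH; rewrite /g0 Mx_mul !scaler0 mulmx0 !addr0.
    by rewrite intS expfzDr ?gt_eqF // expr1z.
  - have := LM _ _ g0V IH; rewrite Mx_mul !scaler0 mulmx0 !addr0.
    by rewrite intS opprD expfzDr ?gt_eqF.
pose v := (2 * d)%:R * `|row_mx A^T B^T|.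
have v0 : 0 <= v by rewrite mulr_ge0.
have av0 : 0 <= alpha * v by rewrite mulr_ge0 // ltW.
(* The summands bound the scalar, the a, b and c blocks respectively; v bounds a combination of the
   basis with coefficients in [-1, 1]. *)
exists (alpha + alpha * v + v + r0) => _ [x [a [b [c [x0 ->]]]]].
have [n] := expz_scale alpha_gt1 x0; set y := x * alpha ^ n => /andP[y1 ya].
have y0 : 0 < y by rewrite (lt_le_trans _ y1).
pose b' := alpha ^ n *: b.
(* With scalar entry y, right multiplication by M(1, a', ...) adds y a' to a, so the vector to round
   has first part a / y. *)
have [m1 Hm1] := round_row (row_mx (y^-1 *: a) b' *m Q).
have [c0 Lc0] := LAB (- m1).
(* This is the central block after the first two multiplications; the third one adds k to it. *)
pose c1 := c0 + b'^T *m int_comb A (- m1) + c.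
have [k Kk ck] := Hr0 c1.
exists (Mx (alpha ^ n) 0 0 0 *m Mx 1 (int_comb A (- m1)) (int_comb B (- m1)) c0 *m Mx 1 0 0 k).
exists y, (y *: (int_comb A (- m1) + y^-1 *: a)), (int_comb B (- m1) + b'), (c1 + k).
have E : row_mx (int_comb A (- m1) + y^-1 *: a) (int_comb B (- m1) + b') =
    (row_mx (y^-1 *: a) b' *m Q - map_mx intr m1) *m row_mx A^T B^T.
  rewrite mulmxBl -mulmxA QV mulmx1 -row_mx_int_comb opp_row_mx add_row_mx !int_combN.
  by rewrite addrC [X in row_mx _ X = _]addrC.
have : `|row_mx (int_comb A (- m1) + y^-1 *: a) (int_comb B (- m1) + b')| <= v.
  rewrite E (le_trans (mx_norm_mulmx _ _)) // ler_wpM2l //.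
  by rewrite ler_piMl.
rewrite mx_norm_row_mx => /andP[Av Bv]; split.
- by apply: (LM); [apply: (LM)|exact: LK].
- rewrite !mulmxA !Mx_mul !mulr1 !scaler0 !mulmx0 !addr0 !add0r !scale1r -/y -/b'.
  congr Mx; last by rewrite addrC.
  by rewrite scalerDr scalerA mulfV ?gt_eqF // scale1r.
- by rewrite y1 (le_trans ya) // -!addrA lerDl !addr_ge0.
split.
- have : y * `|int_comb A (- m1) + y^-1 *: a| <= alpha * v by rewrite ler_pM ?(ltW y0).
  rewrite normrZ gtr0_norm // => /le_trans; apply.
  have := alpha_gt0; move: (alpha * v) av0 => av av0; lra.
- by rewrite (le_trans Bv) // addrAC lerDr addr_ge0 // addr_ge0 // ltW.
- by rewrite (le_trans ck) // lerDr !addr_ge0 // ltW.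
Qed.

End LatticeProperties.

(** * Assembly from the model group and the bounded representatives *)

Theorem mainTheorem1 (R : realType) (d : nat) (d_odd : odd d)
  (alpha : R) (alpha_gt1 : 1 < alpha)
  (alpha_quadratic : quadratic_algebraic_integer alpha)
  (N : 'M[int]_(2 * d)) (N_SL : \det N = 1)
  (N_diagonalizable : diagonalizable (intmx_to_real R N))
  (N_eigenvalues : char_poly (intmx_to_real R N) =
     ('X - alpha%:P) ^+ d * ('X - (alpha^-1)%:P) ^+ d)
  (A B : 'M[R]_(d, 2 * d))
  (A_basis : is_eigenbasis N alpha A)
  (B_basis : is_eigenbasis N alpha^-1 B)
  (D : set 'M[R]_(d + (1 + d)))
  (D_lattice : cocompact_lattice (@subgroupZ R d) D)
  (D_z : forall s t, D (z_gen A B s t))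
  (h : 'I_(d ^ 2) -> 'M[R]_d)
  (D_generated : D = matrix_group_generated (range (h_gen h)))
  (P : 'M[int]_(2 * d, d ^ 2))
  (C : 'I_(2 * d) -> 'M[R]_d)
  (C_solution : forall k i j,
     C k i j = \sum_s (N k s)%:~R * C s i j + f_mx A B N k i j
               + \sum_l (P k l)%:~R * h l i j) :
  cocompact_lattice (@groupG R d) (Lambda A B alpha C h).
Proof.
have alpha_gt0 : 0 < alpha by rewrite (lt_trans _ alpha_gt1).
have alpha_neqV : alpha != alpha^-1.
  by rewrite gt_eqF // (lt_trans _ alpha_gt1) // invf_lt1.
have A_eigen := eigenbasis_mul A_basis; have B_eigen := eigenbasis_mul B_basis.
have [Q [QV VQ]] := eigenbases_basis alpha_neqV A_basis B_basis.
have N_unit : N \in unitmx by rewrite unitmxE N_SL unitr1.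
have [[_ D1 DM DV] _ D_isolated _] := D_lattice.
pose K : set 'M[R]_d := [set c | D (Mx 1 0 0 c)].
have K0 : K 0 by rewrite /K /= Mx1.
have KD u v : K u -> K v -> K (u + v).
  move=> Ku Kv; have := DM _ _ Ku Kv.
  by rewrite Mx_mul !scaler0 mulmx0 mulr1 !addr0 addrC.
have KN u : K u -> K (- u).
  move=> /DV; rewrite (Mx_unit_inv 0 0 u (oner_neq0 R)).2.
  by rewrite invr1 !scaler0 mulmx0 scaler0 !oppr0 add0r.
have Kh l : K (h l).
  by rewrite /K /= D_generated; apply: sub_matrix_group_generated; exists l.
have K_disc : exists2 e, 0 < e & forall c, K c -> `|c| <= e -> c = 0.
  have [e e0 eD] := (isolated_eqP D).1 D_isolated _ K0.
  exists e => // c Kc ce; have [] := Mx_inj (eD _ Kc _) => //.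
  by rewrite Mx_norm_le !subrr !normr0 sub0r normrN ce ltW.
(* The value of [gamma] at row k of N is the right-hand side of the linear system without its h
   terms, so the difference is an integer combination of the h_l. *)
have K_row k : K (gamma A B C (row k N) - C k).
  have -> : gamma A B C (row k N) - C k = - \sum_l (P k l)%:~R *: h l.
    apply/matrixP => i j; rewrite !mxE summxE C_solution.
    under [in RHS]eq_bigr do rewrite mxE.
    have -> : ordered_quad (fun s => (row k N 0 s)%:~R) (B i) (A j) = f_mx A B N k i j.
      rewrite mxE /ordered_quad; congr (_ + _); apply: eq_bigr => s _.
        by rewrite !mxE.
      by apply: eq_bigr => t _; rewrite !mxE.
    have -> : \sum_s (row k N 0 s)%:~R * C s i j = \sum_s (N k s)%:~R * C s i j.
      by apply: eq_bigr => s _; rewrite mxE.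
    by ring.
  by apply: (KN); apply: subgroup_sum => // l _; exact: subgroup_int.
have model_group := Lambda_model_group (lt0r_neq0 alpha_gt0) N_unit A_eigen
  B_eigen K0 KD KN D_z K_row.
have gens_model : [set g0 d alpha] `|` range (g_gen A B C) `|` range (h_gen h)
    `<=` Lambda_model alpha A B C K.
  have K_gamma0 : K (- gamma A B C 0) by apply: (KN); apply: gamma0.
  move=> _ [[->|[k _ <-]]|[l _ <-]].
  - by exists 1, 0, 0; rewrite !int_comb0 scaler0 expr1z sub0r.
  - exists 0, (delta_mx 0 k), (C k).
    by rewrite gamma_delta subrr !int_comb_delta expr0z scale1r.
  - exists 0, 0, (h l); rewrite !int_comb0 scaler0 expr0z; split=> //.
    exact: KD.
have Lambda_sub := matrix_group_generated_sub model_group gens_model.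
have Lambda_group := is_matrix_group_generated model_group gens_model.
have gens_Lambda := @sub_matrix_group_generated _ _
  ([set g0 d alpha] `|` range (g_gen A B C) `|` range (h_gen h)).
rewrite -/(Lambda A B alpha C h) in Lambda_sub Lambda_group gens_Lambda *.
split=> //.
- move=> _ /Lambda_sub [n [m [c [_ ->]]]]; do 4 eexists; split; last by [].
  by rewrite exprz_gt0.
- apply/isolated_eqP => x /Lambda_sub /(Lambda_model_discrete alpha_gt1 KD KN VQ K_disc).
  by move=> [e e0 xe]; exists e => // y /Lambda_sub; exact: xe.
case: (Lambda_group) => Lu L1 LM LV.
have LK c : K c -> Lambda A B alpha C h (Mx 1 0 0 c).
  rewrite /K /= D_generated; apply: matrix_group_generated_sub => //.
  by move=> X HX; apply: gens_Lambda; right.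
(* Leaving c free makes the claim stable under sums and opposites of m, which reduces it to the
   generators g_k. *)
have LAB m : exists c, Lambda A B alpha C h (Mx 1 (int_comb A m) (int_comb B m) c).
  elim/(@int_row_ind (2 * d)): m => [|u w [c Lc] [c' Lc']|u [c Lc]|k].
  - by exists 0; rewrite !int_comb0 Mx1.
  - exists (c' + (int_comb B u)^T *m int_comb A w + c).
    by have := LM _ _ Lc Lc'; rewrite Mx_mul mulr1 !scale1r [u + w]addrC !int_combD.
  - exists ((int_comb B u)^T *m int_comb A u - c); rewrite !int_combN.
    by have := LV _ Lc; rewrite (Mx_unit_inv _ _ _ (oner_neq0 R)).2 invr1 !scale1r.
  - exists (C k); rewrite !int_comb_delta; apply: gens_Lambda; left; right.
    by exists k.
have Lg0 : Lambda A B alpha C h (g0 d alpha) by apply: gens_Lambda; left; left.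
have [r Hr] := groupG_cobounded alpha_gt1 K0 KD KN QV D_z Lambda_group Lg0 LAB LK.
exact: coset_space_compact Lambda_group Hr.
Qed.
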